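(* Let $A\in\mathbb C^{6\times6}$ be circularly equivalent to the matrix $$M=\begin{bmatrix}0&0&0&1&0&0\\0&0&0&0&b&0\\0&0&0&0&c&e\\0&0&0&0&d&f\\0&0&0&0&0&g\\0&0&0&0&0&h\end{bmatrix},$$ where $b,c,d,e,h\ge0$, $f,g\in\mathbb R$, $f\ge0$ if $ce=0$ and $f\le0$ otherwise, $b^2+c^2+d^2=1$, $e^2+f^2+g^2+h^2=1$, $ce+df=0$, and suppose $cdefgh\ne0$. Then $W(A)$ is a circular disk if and only if $d^2+\frac{ceg}{h}\ge0$ and, with $x=\sqrt{d^2+\frac{ceg}{h}}$, both $$cegh-d^2g^2+\Bigl(e^2+h^2+\frac{ceg}{h}-1\Bigr)x=0,\qquad x\le3,$$ and $$3x^2+2h^2x+h^2+e^2-d^2-1>4hx\sqrt{1+x}$$ hold.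
   Context: Matrices $A$ and $B$ are circularly equivalent ($A\sim B$) if $B=e^{i\theta}UAU^*$ for some unitary $U$ and real $\theta$. $W(A)=\{\langle Ax,x\rangle:\|x\|=1\}$ is the numerical range of $A$. *)

(* Defs.v *)
From mathcomp Require Import all_boot all_order all_algebra.
From mathcomp Require Import complex.
From mathcomp Require Import all_classical all_reals all_analysis.

Set Implicit Arguments.
Unset Strict Implicit.
Unset Printing Implicit Defensive.

Import Order.TTheory GRing.Theory Num.Theory.
Local Open Scope ring_scope.
Local Open Scope complex_scope.
Local Open Scope classical_set_scope.
Local Open Scope sesquilinear_scope.

(* The inner product is linear in the first argument: <u, v> = v^* u. *)
Definition cdot (R : realType) (n : nat) (u v : 'cV[R[i]]_n) : R[i] :=
  \sum_(k < n) u k 0 * (v k 0)^*%R.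

Definition cnorm (R : realType) (n : nat) (u : 'cV[R[i]]_n) : R :=
  Num.sqrt (complex.Re (cdot u u)).

Definition numerical_range (R : realType) (n : nat) (A : 'M[R[i]]_n) :
  set R[i] :=
  [set cdot (A *m x) x | x in [set x : 'cV[R[i]]_n | cnorm x = 1]].

Definition cexpi (R : realType) (theta : R) : R[i] := cos theta +i* sin theta.

Definition circularly_equivalent (R : realType) (n : nat)
    (A B : 'M[R[i]]_n) : Prop :=
  exists (theta : R) (U : 'M[R[i]]_n),
    U \is unitarymx /\ B = cexpi theta *: (U *m A *m U^t*).

(* Closed disk of positive radius, with arbitrary center. *)
Definition circular_disk (R : realType) (D : set R[i]) : Prop :=
  exists (z : R[i]) (r : R), 0 < r /\ D = [set w : R[i] | `|w - z| <= r%:C].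

Definition mx_of_rows (T : pzRingType) (n : nat) (rows : seq (seq T)) : 'M[T]_n :=
  \matrix_(i < n, j < n) nth 0 (nth [::] rows i) j.

Definition modelM (R : realType) (b c d e f g h : R) : 'M[R[i]]_6 :=
  map_mx (real_complex R) (mx_of_rows 6
    [:: [:: 0; 0; 0; 1; 0; 0];
        [:: 0; 0; 0; 0; b; 0];
        [:: 0; 0; 0; 0; c; e];
        [:: 0; 0; 0; 0; d; f];
        [:: 0; 0; 0; 0; 0; g];
        [:: 0; 0; 0; 0; 0; h]]).

(* Main.v *)
Require Import Defs.
From mathcomp Require Import all_boot all_order all_algebra.
From mathcomp Require Import complex ring lra.
From mathcomp Require Import all_classical all_reals all_analysis.

(** Write M in 3 by 3 blocks as [[0, B], [0, C]]. The hypotheses on the last two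
    columns say that M is a partial isometry: B' B + C' C = 1, where a prime
    denotes the adjoint, or the conjugate of a scalar. The nonzero entries of C are
    d, f, g, h. For a unit complex number w and a real l > 0 put x = l^2 - 1;
    below, v1, ..., v6 are the coordinates of a vector v. Eliminating the first
    three coordinates from the Hermitian matrix l - (w M + w' M') leaves, up to the
    factor l, the matrix
      K = x + C' C - l (w C + w' C'),
    and det K = detK0 x + l (w + w') detK1 x with
      detK0 x = x^3 + h^2 x^2 - (f^2 + g^2 + d^2) x - d^2 (g^2 + h^2),
      detK1 x = d^2 h - d f g - h x^2.
    As d f = - c e, the equation detK1 x = 0 says x^2 = d^2 + c e g / h, and then
    detK0 x = 0 is the displayed equation of the statement.

    Suppose W(M) is a disk of radius r > 0. Its center a is real because M is
    real ([disk_center_real]). In the direction w, with t = Re w, the disk has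
    support l / 2 where l = 2 (r + a t), and the support is attained; hence l is
    an eigenvalue of w M + w' M' and det K = 0 ([disk_support_det]). If a were
    not 0, multiplication by a would turn this into a polynomial identity in l
    whose coefficient of degree 5 is 2 r h, a contradiction ([disk_center_eq0]).
    So a = 0, the number l = 2 r does not depend on t, and
    detK0 x = detK1 x = 0. Moreover K >= 0, so its leading 2 by 2 minor x^2 - d^2
    is nonnegative ([model_disk_minor_ge0]); it is not 0 because c e g is not.

    Conversely let detK0 x = detK1 x = 0 and x^2 > d^2. An LDL decomposition
    ([support_form_LDL]) shows that K is positive semidefinite and singular for
    every w, so W(M) lies in the disk of center 0 and radius l / 2 and reaches its
    boundary in every direction. Rescaling the last three coordinates of an
    extremal vector gives, by the intermediate value theorem, all the points
    between the center and the boundary point ([model_disk_sufficient]).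

    The last inequality of the statement is another form of x^2 > d^2: when
    both detK0 x and detK1 x vanish, the difference of its two sides multiplied
    by 2 l^2 (x^2 - d^2) equals u^T (x + 2 - C^T C) u, where u is the last column
    of the adjugate of K at w = 1, and this is positive because C^T C <= 1
    ([slope_identity], [slope_gt0]). That difference times 2 l is the derivative
    of det K with respect to l at w = 1. The bound x <= 3 is a consequence of
    detK0 x = 0 ([detK0_root_le3]). *)

Set Implicit Arguments.
Unset Strict Implicit.
Unset Printing Implicit Defensive.

Import Order.TTheory GRing.Theory Num.Theory.
Local Open Scope ring_scope.
Local Open Scope complex_scope.
Local Open Scope sesquilinear_scope.

(** * The inner product and numerical ranges *)

Lemma conj_real (R : realType) (x : R) : (x%:C)^*%R = x%:C.
Proof. exact: conjc_real. Qed.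

Lemma cdotE (R : realType) n (u v : 'cV[R[i]]_n) : cdot u v = (v^t* *m u) 0 0.
Proof. by rewrite mxE; apply: eq_bigr => k _; rewrite !mxE mulrC. Qed.

Lemma cdot_mul (R : realType) n (A : 'M[R[i]]_n) (u v : 'cV[R[i]]_n) :
  cdot (A *m u) v = cdot u (A^t* *m v).
Proof. by rewrite !cdotE trmx_mul map_mxM /= trmxCK mulmxA. Qed.

Lemma cdotDl (R : realType) n (u u' v : 'cV[R[i]]_n) :
  cdot (u + u') v = cdot u v + cdot u' v.
Proof. by rewrite !cdotE mulmxDr mxE. Qed.

Lemma cdotZl (R : realType) n k (u v : 'cV[R[i]]_n) :
  cdot (k *: u) v = k * cdot u v.
Proof. by rewrite !cdotE -scalemxAr mxE. Qed.

Lemma cdotC (R : realType) n (u v : 'cV[R[i]]_n) :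
  (cdot u v)^*%R = cdot v u.
Proof.
rewrite /cdot rmorph_sum; apply: eq_bigr => k _.
by rewrite rmorphM /= conjCK mulrC.
Qed.

Lemma cdotDr (R : realType) n (u v v' : 'cV[R[i]]_n) :
  cdot u (v + v') = cdot u v + cdot u v'.
Proof. by rewrite -cdotC cdotDl rmorphD /= !cdotC. Qed.

Lemma cdotZr (R : realType) n k (u v : 'cV[R[i]]_n) :
  cdot u (k *: v) = k^*%R * cdot u v.
Proof. by rewrite -cdotC cdotZl rmorphM /= cdotC. Qed.

Lemma cdot_ge0 (R : realType) n (u : 'cV[R[i]]_n) : 0 <= cdot u u.
Proof. by apply: sumr_ge0 => k _; apply: mul_conjC_ge0. Qed.

Lemma cdot_eq0 (R : realType) n (u : 'cV[R[i]]_n) : cdot u u = 0 -> u = 0.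
Proof.
move=> /eqP; rewrite psumr_eq0; last by move=> k _; apply: mul_conjC_ge0.
move=> /allP u0; apply/matrixP => k j; rewrite ord1 mxE.
by have := u0 k (mem_index_enum k); rewrite mul_conjC_eq0 => /eqP.
Qed.

Lemma cdot_real (R : realType) n (u : 'cV[R[i]]_n) :
  cdot u u = (complex.Re (cdot u u))%:C.
Proof. by rewrite RRe_real // ger0_real // cdot_ge0. Qed.

Lemma cnorm_eq1 (R : realType) n (u : 'cV[R[i]]_n) :
  cnorm u = 1 <-> cdot u u = 1.
Proof.
have u0 : 0 <= complex.Re (cdot u u) by rewrite -ler0c -cdot_real cdot_ge0.
rewrite /cnorm; split=> [u1|->]; last by rewrite /= sqrtr1.
by rewrite cdot_real -(sqr_sqrtr u0) u1 expr1n.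
Qed.

Lemma numerical_rangeP (R : realType) n (A : 'M[R[i]]_n) w :
  numerical_range A w <->
  exists2 v, cdot v v = 1 & w = cdot (A *m v) v.
Proof.
split=> [[v /= /cnorm_eq1 v1 <-]|[v v1 ->]]; first by exists v.
by exists v => //=; apply/cnorm_eq1.
Qed.

(** Vectors need not be normalized: the Rayleigh quotient of a vector of squared
    norm m > 0 lies in the numerical range. *)
Lemma numerical_range_scale (R : realType) n (A : 'M[R[i]]_n)
    (v : 'cV[R[i]]_n) (m : R) : 0 < m -> cdot v v = m%:C ->
  numerical_range A (cdot (A *m v) v / m%:C).
Proof.
move=> m0 vm; apply/numerical_rangeP.
have km : ((Num.sqrt m)^-1)%:C * ((Num.sqrt m)^-1)%:C = (m%:C)^-1.
  by rewrite -rmorphM -invfM -expr2 sqr_sqrtr ?ltW // fmorphV.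
exists (((Num.sqrt m)^-1)%:C *: v).
  rewrite cdotZl cdotZr conj_real mulrA km vm mulVf //.
  by rewrite fmorph_eq0 gt_eqF.
by rewrite -scalemxAr cdotZl cdotZr conj_real mulrA km mulrC.
Qed.

(** Homogeneous form of the inclusion of the numerical range in a disk. *)
Lemma numerical_range_disk (R : realType) n (A : 'M[R[i]]_n) z (r : R) :
  numerical_range A = [set w : R[i] | `|w - z| <= r%:C]%classic ->
  forall v, `|cdot (A *m v) v - z * cdot v v| <= r%:C * cdot v v.
Proof.
move=> WA v; have [v0|vn0] := eqVneq (cdot v v) 0.
  by rewrite v0 (cdot_eq0 v0) mulmx0 cdotE mulmx0 mxE !mulr0 subr0 normr0.
have vgt : 0 < cdot v v by rewrite lt_def vn0 cdot_ge0.
have mgt : 0 < complex.Re (cdot v v) by rewrite -ltcR -cdot_real.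
have := numerical_range_scale A mgt (cdot_real v).
rewrite WA /= -cdot_real => le.
have -> : cdot (A *m v) v - z * cdot v v =
    (cdot (A *m v) v / cdot v v - z) * cdot v v by field.
by rewrite normrM (gtr0_norm vgt) ler_pM2r.
Qed.

(** An isotropic vector of a positive semidefinite matrix lies in its kernel. The
    form is evaluated at v - s N v for small s > 0. *)
Lemma psd_kernel (R : realType) n (N : 'M[R[i]]_n) (v : 'cV[R[i]]_n) :
  N^t* = N -> (forall u, 0 <= cdot (N *m u) u) -> cdot (N *m v) v = 0 ->
  N *m v = 0.
Proof.
move=> Nh Npsd v0; set y := N *m v; apply: cdot_eq0.
have yN : cdot (N *m y) v = cdot y y by rewrite cdot_mul Nh.
have q (s : R) : 0 <= - 2 * s * complex.Re (cdot y y) + s ^+ 2 * complex.Re (cdot (N *m y) y).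
  have := Npsd (v + (- s)%:C *: y); rewrite mulmxDr -scalemxAr !cdotDl !cdotDr.
  rewrite !cdotZl !cdotZr conj_real v0 yN -/y cdot_real.
  have -> : cdot (N *m y) y = (complex.Re (cdot (N *m y) y))%:C.
    by rewrite RRe_real // ger0_real // Npsd.
  by rewrite -!rmorphM -!rmorphD /= ?add0r -?rmorphD ler0c => le; lra.
rewrite cdot_real; have y0 : 0 <= complex.Re (cdot y y).
  by rewrite -ler0c -cdot_real cdot_ge0.
have Ny0 : 0 <= complex.Re (cdot (N *m y) y).
  by rewrite -ler0c RRe_real ?Npsd // ger0_real // Npsd.
move: y0 Ny0 q; move: (complex.Re _) (complex.Re (cdot (N *m y) y)) => p k p0 k0 q.
clear - p0 k0 q.
suff -> : p = 0 by [].
(* With k the value of the form at y, this s makes the quadratic bound on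
   p = |y|^2 equal to - s^2 (k + 2). *)
have := q (p / (k + 1)); have k1 : 0 < k + 1 by rewrite ltr_wpDl.
have -> : -2 * (p / (k + 1)) * p + (p / (k + 1)) ^+ 2 * k =
   - (p / (k + 1)) ^+ 2 * (k + 2) by field; rewrite gt_eqF.
rewrite mulNr oppr_ge0 pmulr_lle0 ?exprn_even_le0 //=; last by lra.
by rewrite mulf_eq0 invr_eq0 (gt_eqF k1) orbF => /eqP.
Qed.

(** If Re (w z) <= l / 2 on the numerical range, with equality at the value of the
    unit vector v, then v is an eigenvector of w A + w' A' for the eigenvalue l.
    Both conditions are stated in homogeneous form. *)
Lemma support_eigenvector (R : realType) n (A : 'M[R[i]]_n) (w : R[i]) (l : R)
    (v : 'cV[R[i]]_n) :
  (forall u, 0 <= l%:C * cdot u u - w * cdot (A *m u) u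
                   - (w * cdot (A *m u) u)^*%R) ->
  l%:C * cdot v v - w * cdot (A *m v) v - (w * cdot (A *m v) v)^*%R = 0 ->
  l%:C *: v = w *: (A *m v) + w^*%R *: (A^t* *m v).
Proof.
move=> ge0 eq0.
pose N : 'M[R[i]]_n := (l%:C)%:M + ((- w) *: A + (- w^*%R) *: A^t*).
have qE u : cdot (N *m u) u = l%:C * cdot u u - w * cdot (A *m u) u
                   - (w * cdot (A *m u) u)^*%R.
  rewrite /N !mulmxDl mul_scalar_mx -!scalemxAl !cdotDl !cdotZl !mulNr addrA.
  by rewrite rmorphM /= cdotC [X in _ - _ - _ * X]cdot_mul trmxCK.
suff : N *m v = 0.
  rewrite /N !mulmxDl mul_scalar_mx -!scalemxAl => /eqP.
  by rewrite !scaleNr -opprD subr_eq0 => /eqP.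
apply: psd_kernel => [|u|]; rewrite ?qE //.
apply/matrixP => i j; rewrite !mxE.
rewrite !rmorphD !rmorphM /= !rmorphN /= rmorphMn /= conj_real !conjCK eq_sym.
by rewrite [X in _ + X]addrC.
Qed.

(** * Invariance under circular equivalence *)

Lemma circularly_equivalent_sym (R : realType) n (A B : 'M[R[i]]_n) :
  circularly_equivalent A B -> circularly_equivalent B A.
Proof.
move=> [t [U [Uu ->]]]; exists (- t), (U^t*); rewrite trmxC_unitary; split=> //.
rewrite trmxCK -scalemxAr -scalemxAl scalerA /cexpi cosN sinN.
have -> : (cos t +i* - sin t) * (cos t +i* sin t) = 1 :> R[i].
  by apply/eqP; rewrite eq_complex /= -(cos2Dsin2 t); apply/andP; split; apply/eqP; ring.
have UU : U^t* *m U = 1%:M.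
  by rewrite -[LHS]mul1mx mulmxA mulmxKtV.
by rewrite scale1r -!mulmxA UU mulmx1 !mulmxA UU mul1mx.
Qed.

Lemma normc_cexpi (R : realType) (t : R) : `|cexpi t| = 1.
Proof. by rewrite normc_def /= cos2Dsin2 sqrtr1. Qed.

Lemma numerical_range_circ (R : realType) n (A B : 'M[R[i]]_n) :
  circularly_equivalent A B ->
  exists2 k : R[i], `|k| = 1 &
    forall w, numerical_range B (k * w) <-> numerical_range A w.
Proof.
move=> [t [U [Uu ->]]]; exists (cexpi t); first exact: normc_cexpi.
have kn0 : cexpi t != 0 by rewrite -normr_gt0 normc_cexpi.
have UU : U^t* *m U = 1%:M.
  by rewrite -[LHS]mul1mx mulmxA mulmxKtV.
have UUt : U *m U^t* = 1%:M by apply/unitarymxP.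
have E (v : 'cV_n) : cdot ((cexpi t *: (U *m A *m U^t*)) *m v) v =
    cexpi t * cdot (A *m (U^t* *m v)) (U^t* *m v).
  rewrite -scalemxAl cdotZl -!mulmxA cdot_mul //.
move=> w; split=> /numerical_rangeP[v v1 wE]; apply/numerical_rangeP.
  exists (U^t* *m v); first by rewrite cdot_mul trmxCK mulmxA UUt mul1mx.
  by apply: (mulfI kn0); rewrite wE E.
have UUv : U^t* *m (U *m v) = v by rewrite mulmxA UU mul1mx.
exists (U *m v); first by rewrite cdot_mul UUv.
by rewrite E UUv wE.
Qed.

Lemma circular_disk_circ (R : realType) n (A B : 'M[R[i]]_n) :
  circularly_equivalent A B ->
  circular_disk (numerical_range A) -> circular_disk (numerical_range B).
Proof.
move=> /numerical_range_circ[k k1 kW] [z [r [r0 WA]]].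
have kn0 : k != 0 by rewrite -normr_gt0 k1.
exists (k * z), r; split=> //; apply/seteqP; split=> w /=.
  rewrite -{1}(mulVKf kn0 w) kW WA /= => le.
  by rewrite -(mulVKf kn0 w) -mulrBr normrM k1 mul1r.
rewrite -{2}(mulVKf kn0 w) kW WA /= => le.
by rewrite -[leLHS]mul1r -k1 -normrM mulrBr mulVKf.
Qed.

(** * Complex scalars *)

Lemma add_conj_le (C : numClosedFieldType) (z k : C) :
  `|z| <= k -> 0 <= 2 * k - z - z^*%R.
Proof.
move=> zk; have -> : 2 * k - z - z^*%R = 2 * (k - 'Re z) by rewrite ReE; field.
by rewrite mulr_ge0 // subr_ge0 (le_trans _ zk) // leif_Re_Creal.
Qed.

Lemma normr_add_conj (C : numClosedFieldType) (z : C) :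
  z + z^*%R = 2 * `|z| -> z = `|z|.
Proof.
move=> zz; have /eqP : 'Re z = `|z| by rewrite ReE zz mulrAC divff ?mul1r ?pnatr_eq0.
by rewrite (leif_Re_Creal z) => /ger0_norm.
Qed.

Lemma norm1_mul_conj (C : numClosedFieldType) (w : C) : `|w| = 1 -> w * w^*%R = 1.
Proof. by move=> w1; rewrite -normCK w1 expr1n. Qed.

Lemma ltr0C (R : realType) (x : R) : (0 < x%:C) = (0 < x).
Proof. exact: (ltcR 0 x). Qed.

Lemma phase_exists (R : realType) (p : R[i]) :
  exists2 w : R[i], `|w| = 1 & w * p = `|p|.
Proof.
have [->|p0] := eqVneq p 0; first by exists 1; rewrite ?normr1 // mulr0 normr0.
exists (`|p| / p); last by rewrite mulfVK.
by rewrite normrM normrV ?unitfE // normr_id divff // normr_eq0.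
Qed.

Lemma sqr_normc_real (R : realType) (z : R[i]) :
  `|z| ^+ 2 = (complex.Re z ^+ 2 + complex.Im z ^+ 2)%:C.
Proof. by rewrite add_Re2_Im2. Qed.

(** * Determinant and decomposition of the reduced matrix *)

(** The part of det K that does not depend on the direction w. *)
Definition detK0 (F : pzRingType) (d f g h x : F) : F :=
  x ^+ 3 + h ^+ 2 * x ^+ 2 - (f ^+ 2 + g ^+ 2 + d ^+ 2) * x
    - d ^+ 2 * (g ^+ 2 + h ^+ 2).

(** The coefficient of l (w + w') in det K. *)
Definition detK1 (F : pzRingType) (d f g h x : F) : F :=
  d ^+ 2 * h - d * f * g - h * x ^+ 2.

(** Cramer's rule: a 3 by 3 matrix sending v to 0 has D v = 0, D its determinant. *)
Lemma adj3_kernel (F : comPzRingType)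
    (k11 k12 k13 k21 k22 k23 k31 k32 k33 v1 v2 v3 : F) :
  k11 * v1 + k12 * v2 + k13 * v3 = 0 ->
  k21 * v1 + k22 * v2 + k23 * v3 = 0 ->
  k31 * v1 + k32 * v2 + k33 * v3 = 0 ->
  let D := k11 * (k22 * k33 - k23 * k32) - k12 * (k21 * k33 - k23 * k31)
           + k13 * (k21 * k32 - k22 * k31) in
  [/\ D * v1 = 0, D * v2 = 0 & D * v3 = 0].
Proof.
move=> e1 e2 e3 D; split.
- transitivity ((k22 * k33 - k23 * k32) * (k11 * v1 + k12 * v2 + k13 * v3)
    - (k12 * k33 - k13 * k32) * (k21 * v1 + k22 * v2 + k23 * v3)
    + (k12 * k23 - k13 * k22) * (k31 * v1 + k32 * v2 + k33 * v3)).
    by rewrite /D; ring.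
  by rewrite e1 e2 e3 !mulr0 subr0 addr0.
- transitivity (- (k21 * k33 - k23 * k31) * (k11 * v1 + k12 * v2 + k13 * v3)
    + (k11 * k33 - k13 * k31) * (k21 * v1 + k22 * v2 + k23 * v3)
    - (k11 * k23 - k13 * k21) * (k31 * v1 + k32 * v2 + k33 * v3)).
    by rewrite /D; ring.
  by rewrite e1 e2 e3 !mulr0 subr0 addr0.
- transitivity ((k21 * k32 - k22 * k31) * (k11 * v1 + k12 * v2 + k13 * v3)
    - (k11 * k32 - k12 * k31) * (k21 * v1 + k22 * v2 + k23 * v3)
    + (k11 * k22 - k12 * k21) * (k31 * v1 + k32 * v2 + k33 * v3)).
    by rewrite /D; ring.
  by rewrite e1 e2 e3 !mulr0 subr0 addr0.
Qed.

(** The three equations say that (v4, v5, v6) is in the kernel of K, so det K = 0. *)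
Lemma det_kernel (F : fieldType) (d f g h l w w' x v4 v5 v6 : F) :
  w * w' = 1 -> l ^+ 2 = 1 + x ->
  x * v4 = l * w * (d * v5 + f * v6) ->
  (x + d ^+ 2) * v5 + (d * f - l * w * g) * v6 = l * w' * d * v4 ->
  (x + f ^+ 2 + g ^+ 2 + h ^+ 2 - l * h * (w + w')) * v6
    + (d * f - l * w' * g) * v5 = l * w' * f * v4 ->
  [|| v4 != 0, v5 != 0 | v6 != 0] ->
  detK0 d f g h x + l * (w + w') * detK1 d f g h x = 0.
Proof.
move=> ww' l2 e4 e5 e6 vn0.
pose k33 := x + f ^+ 2 + g ^+ 2 + h ^+ 2 - l * h * (w + w').
have [||| D4 D5 D6] := @adj3_kernel F x (- (l * w * d)) (- (l * w * f))
  (- (l * w' * d)) (x + d ^+ 2) (d * f - l * w * g)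
  (- (l * w' * f)) (d * f - l * w' * g) k33 v4 v5 v6.
- by rewrite e4; ring.
- by rewrite mulNr -e5; ring.
- by rewrite mulNr -e6 /k33; ring.
set D := (X in X * v4 = 0) in D4 D5 D6.
suff <- : D = detK0 d f g h x + l * (w + w') * detK1 d f g h x.
  have cancelD v : v != 0 -> D * v = 0 -> D = 0.
    by move=> vn0' /eqP; rewrite mulf_eq0 (negPf vn0') orbF => /eqP.
  by case/or3P: vn0 => /cancelD; apply.
(* The determinant and the claimed value differ by a multiple of
   l^2 w w' - 1 - x, which vanishes. *)
apply/eqP; rewrite -subr_eq0; apply/eqP.
transitivity ((l ^+ 2 * (w * w') - 1 - x) *
    (- x * g ^+ 2 - d ^+ 2 * k33 - f ^+ 2 * (x + d ^+ 2)
     + d * f * (2 * d * f - l * g * (w + w')))).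
  by rewrite /D /k33 /detK0 /detK1; ring.
by rewrite ww' l2; ring.
Qed.

(** Here u_i and w' stand for the conjugates of v_i and w, so the left-hand side is
    l times the form of l - (w M + w' M'), and the last parenthesis is the form of
    K at (v4, v5, v6). *)
Lemma support_form_schur (F : comPzRingType)
    (b c d e f g h l x w w' v1 v2 v3 v4 v5 v6 u1 u2 u3 u4 u5 u6 : F) :
  w * w' = 1 -> l ^+ 2 = 1 + x -> b ^+ 2 + c ^+ 2 + d ^+ 2 = 1 ->
  e ^+ 2 + f ^+ 2 + g ^+ 2 + h ^+ 2 = 1 -> c * e + d * f = 0 ->
  l *
    (l * (v1 * u1 + v2 * u2 + v3 * u3 + v4 * u4 + v5 * u5 + v6 * u6)
     - w * (v4 * u1 + b * v5 * u2 + (c * v5 + e * v6) * u3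
            + (d * v5 + f * v6) * u4 + g * v6 * u5 + h * v6 * u6)
     - w' * (u4 * v1 + b * u5 * v2 + (c * u5 + e * u6) * v3
            + (d * u5 + f * u6) * v4 + g * u6 * v5 + h * u6 * v6)) =
  (l * v1 - w * v4) * (l * u1 - w' * u4)
  + (l * v2 - w * b * v5) * (l * u2 - w' * b * u5)
  + (l * v3 - w * (c * v5 + e * v6)) * (l * u3 - w' * (c * u5 + e * u6))
  + (x * v4 * u4 + (x + d ^+ 2) * v5 * u5
     + (x + f ^+ 2 + g ^+ 2 + h ^+ 2 - l * h * (w + w')) * v6 * u6
     + d * f * (v5 * u6 + v6 * u5)
     - l * w * ((d * v5 + f * v6) * u4 + g * v6 * u5)
     - l * w' * ((d * u5 + f * u6) * v4 + g * u6 * v5)).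
Proof.
move=> ww l2 hcol5 hcol6 horth.
apply/eqP; rewrite -subr_eq0; apply/eqP.
transitivity ((l ^+ 2 - 1 - x) * (v4 * u4 + v5 * u5 + v6 * u6)
   - ((w * w' - 1) * (v4 * u4 + b ^+ 2 * v5 * u5
      + (c * v5 + e * v6) * (c * u5 + e * u6))
   + (b ^+ 2 + c ^+ 2 + d ^+ 2 - 1) * v5 * u5
   + (e ^+ 2 + f ^+ 2 + g ^+ 2 + h ^+ 2 - 1) * v6 * u6
   + (c * e + d * f) * (v5 * u6 + v6 * u5))).
  by ring.
by rewrite l2 ww hcol5 hcol6 horth; ring.
Qed.

(** LDL decomposition of K: its leading minors are x and x^2 - d^2, and the last
    pivot is det K = 0. *)
Lemma schur_form_LDL (F : comPzRingType)
    (d f g h l x w w' v4 v5 v6 u4 u5 u6 : F) :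
  w * w' = 1 -> l ^+ 2 = 1 + x ->
  detK0 d f g h x + l * (w + w') * detK1 d f g h x = 0 ->
  x * (x ^+ 2 - d ^+ 2) *
    (x * v4 * u4 + (x + d ^+ 2) * v5 * u5
     + (x + f ^+ 2 + g ^+ 2 + h ^+ 2 - l * h * (w + w')) * v6 * u6
     + d * f * (v5 * u6 + v6 * u5)
     - l * w * ((d * v5 + f * v6) * u4 + g * v6 * u5)
     - l * w' * ((d * u5 + f * u6) * v4 + g * u6 * v5)) =
  (x ^+ 2 - d ^+ 2) *
    ((x * v4 - l * w * (d * v5 + f * v6)) * (x * u4 - l * w' * (d * u5 + f * u6)))
  + ((x ^+ 2 - d ^+ 2) * v5 - (d * f + l * w * g * x) * v6)
    * ((x ^+ 2 - d ^+ 2) * u5 - (d * f + l * w' * g * x) * u6).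
Proof.
move=> ww l2 hD.
apply/eqP; rewrite -subr_eq0; apply/eqP.
transitivity (- (l ^+ 2 * (w * w') - 1 - x) *
   ((x ^+ 2 - d ^+ 2) * (d * v5 + f * v6) * (d * u5 + f * u6)
    + g ^+ 2 * x ^+ 2 * v6 * u6)
  + x * (detK0 d f g h x + l * (w + w') * detK1 d f g h x) * v6 * u6).
  by rewrite /detK0 /detK1; ring.
by rewrite ww l2 hD; ring.
Qed.

(** The six equations say that v is an eigenvector of w M + w' M' for the
    eigenvalue l; the first three coordinates are eliminated. *)
Lemma eigenvector_det (F : fieldType)
    (b c d e f g h l x w w' v1 v2 v3 v4 v5 v6 : F) :
  w * w' = 1 -> l ^+ 2 = 1 + x -> l != 0 -> b ^+ 2 + c ^+ 2 + d ^+ 2 = 1 ->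
  e ^+ 2 + f ^+ 2 + g ^+ 2 + h ^+ 2 = 1 -> c * e + d * f = 0 ->
  l * v1 = w * v4 ->
  l * v2 = w * (b * v5) ->
  l * v3 = w * (c * v5 + e * v6) ->
  l * v4 = w * (d * v5 + f * v6) + w' * v1 ->
  l * v5 = w * (g * v6) + w' * (b * v2 + c * v3 + d * v4) ->
  l * v6 = w * (h * v6) + w' * (e * v3 + f * v4 + g * v5 + h * v6) ->
  ~ [/\ v1 = 0, v2 = 0 & v3 = 0] \/ ~ [/\ v4 = 0, v5 = 0 & v6 = 0] ->
  detK0 d f g h x + l * (w + w') * detK1 d f g h x = 0.
Proof.
move=> ww l2 l0 hcol5 hcol6 horth e1 e2 e3 e4 e5 e6 vn0.
have xE : x = l * l - 1 by rewrite -expr2 l2 addrC addKr.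
have e4' : l * (l * v4) = l * w * (d * v5 + f * v6) + (w * w') * v4.
  by rewrite e4 mulrDr [l * (w' * _)]mulrCA e1; ring.
have e5' : l * (l * v5) = l * w * g * v6 + l * w' * d * v4
    + (w * w') * (b ^+ 2 * v5 + c * (c * v5 + e * v6)).
  transitivity (l * w * g * v6 + w' * (b * (l * v2) + c * (l * v3) + d * (l * v4))).
    by rewrite e5; ring.
  by rewrite e2 e3; ring.
have e6' : l * (l * v6) = l * (w + w') * h * v6 + l * w' * f * v4 + l * w' * g * v5
    + (w * w') * (e * (c * v5 + e * v6)).
  transitivity (l * w * h * v6
     + w' * (e * (l * v3) + f * (l * v4) + g * (l * v5) + h * (l * v6))).
    by rewrite {1}e6; ring.
  by rewrite e3; ring.
apply: (@det_kernel F d f g h l w w' x v4 v5 v6) => //.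
- have -> : x * v4 = l * (l * v4) - v4 by rewrite xE; ring.
  by rewrite e4' ww; ring.
- apply/eqP; rewrite -subr_eq0; apply/eqP.
  transitivity (l * (l * v5) - (l * w * g * v6 + l * w' * d * v4
      + (b ^+ 2 * v5 + c * (c * v5 + e * v6)))
    + (b ^+ 2 + c ^+ 2 + d ^+ 2 - 1) * v5 + (c * e + d * f) * v6).
    by rewrite xE; ring.
  by rewrite e5' ww hcol5 horth; ring.
- apply/eqP; rewrite -subr_eq0; apply/eqP.
  transitivity (l * (l * v6) - (l * (w + w') * h * v6 + l * w' * f * v4
      + l * w' * g * v5 + e * (c * v5 + e * v6))
    + (e ^+ 2 + f ^+ 2 + g ^+ 2 + h ^+ 2 - 1) * v6 + (c * e + d * f) * v5).
    by rewrite xE; ring.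
  by rewrite e6' ww hcol6 horth; ring.
have [v4E|//] := eqVneq v4 0; have [v5E|//] := eqVneq v5 0.
have [v6E|//] := eqVneq v6 0; case: vn0 => [[]|[]] //.
move: e1 e2 e3; rewrite v4E v5E v6E !mulr0 addr0 mulr0.
by split; apply: (mulfI l0); rewrite mulr0.
Qed.

(** At a common zero of detK0 and detK1. The vector (v4, v5, v6) is the last column
    of the adjugate of K at w = 1, and the right-hand side is the value at this
    vector of the form of x + 2 - C^T C. *)
Lemma slope_identity (F : comPzRingType) (d f g h l x : F) :
  l ^+ 2 = 1 + x -> detK0 d f g h x = 0 -> detK1 d f g h x = 0 ->
  let v4 := l * (f * x + l * d * g) in
  let v5 := d * f + l * g * x in
  let v6 := x ^+ 2 - d ^+ 2 in
  2 * l ^+ 2 * (3 * x ^+ 2 + 2 * h ^+ 2 * x - (f ^+ 2 + g ^+ 2 + d ^+ 2)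
     - 4 * h * x * l) * v6 =
  (x + 2) * (v4 ^+ 2 + v5 ^+ 2 + v6 ^+ 2) - (d * v5 + f * v6) ^+ 2
    - (g ^+ 2 + h ^+ 2) * v6 ^+ 2.
Proof.
move=> l2 h0 h1 /=.
have xE : x = l ^+ 2 - 1 by rewrite l2 addrC addKr.
apply/eqP; rewrite -subr_eq0; apply/eqP.
transitivity (- 2 * l * detK1 d f g h x * (x ^+ 2 - d ^+ 2) +
  (x ^+ 2 - d ^+ 2 + 4 * l ^+ 2 * x)
    * (detK0 d f g h x + 2 * l * detK1 d f g h x)).
  by rewrite /detK0 /detK1 xE; ring.
by rewrite h0 h1; ring.
Qed.

(** As e^2 + h^2 - 1 = - f^2 - g^2, the quantity on the left is the difference of
    the two sides of the last inequality of the theorem. *)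
Lemma slope_gt0 (R : realFieldType) (b c d e f g h l x : R) :
  b ^+ 2 + c ^+ 2 + d ^+ 2 = 1 -> e ^+ 2 + f ^+ 2 + g ^+ 2 + h ^+ 2 = 1 ->
  c * e + d * f = 0 ->
  0 <= x -> l ^+ 2 = 1 + x -> detK0 d f g h x = 0 -> detK1 d f g h x = 0 ->
  x ^+ 2 != d ^+ 2 ->
  (0 < 3 * x ^+ 2 + 2 * h ^+ 2 * x - (f ^+ 2 + g ^+ 2 + d ^+ 2)
     - 4 * h * x * l) = (d ^+ 2 < x ^+ 2).
Proof.
move=> hcol5 hcol6 horth x0 l2 k0 k1 xd.
have := slope_identity l2 k0 k1; cbv zeta.
set v4 := l * _; set v5 := d * f + _; set v6 := x ^+ 2 - _.
set s := _ - 4 * h * x * l => sE.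
have v6n0 : v6 != 0 by rewrite subr_eq0.
have pos : 0 < 2 * l ^+ 2 * s * v6.
  (* C^T C <= 1, written as a sum of squares thanks to B^T B + C^T C = 1. *)
  have -> : 2 * l ^+ 2 * s * v6 = (1 + x) * v6 ^+ 2 + (1 + x) * (v4 ^+ 2 + v5 ^+ 2)
     + v4 ^+ 2 + (b * v5) ^+ 2 + (c * v5 + e * v6) ^+ 2.
    rewrite sE; apply/eqP; rewrite -subr_eq0; apply/eqP.
    transitivity (- (b ^+ 2 + c ^+ 2 + d ^+ 2 - 1) * v5 ^+ 2
      - (e ^+ 2 + f ^+ 2 + g ^+ 2 + h ^+ 2 - 1) * v6 ^+ 2
      - 2 * (c * e + d * f) * v5 * v6); first by ring.
    by rewrite hcol5 hcol6 horth; ring.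
  rewrite -!addrA ltr_pwDl //.
    by rewrite mulr_gt0 ?ltr_pwDl // exprn_even_gt0.
  by rewrite !addr_ge0 ?sqr_ge0 // mulr_ge0 ?addr_ge0 ?sqr_ge0.
have l2pos : 0 < 2 * l ^+ 2 by rewrite l2 mulr_gt0 // ltr_pwDl.
rewrite -(subr_gt0 (d ^+ 2)) -/v6.
apply/idP/idP => gt0.
  by move: pos; rewrite pmulr_rgt0 // mulr_gt0.
by move: pos; rewrite pmulr_lgt0 // pmulr_rgt0.
Qed.

Lemma detK1_eq0 (F : fieldType) (c d e f g h x : F) :
  h != 0 -> c * e + d * f = 0 ->
  (detK1 d f g h x == 0) = (x ^+ 2 == d ^+ 2 + c * e * g / h).
Proof.
move=> h0 horth.
have -> : detK1 d f g h x = h * (d ^+ 2 + c * e * g / h - x ^+ 2).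
  transitivity (h * (d ^+ 2 + c * e * g / h - x ^+ 2) - g * (c * e + d * f)).
    by rewrite /detK1; field.
  by rewrite horth mulr0 subr0.
by rewrite mulf_eq0 (negPf h0) subr_eq0 eq_sym.
Qed.

Lemma detK0E (F : fieldType) (c d e f g h x : F) :
  h != 0 -> e ^+ 2 + f ^+ 2 + g ^+ 2 + h ^+ 2 = 1 ->
  x ^+ 2 = d ^+ 2 + c * e * g / h ->
  detK0 d f g h x = c * e * g * h - d ^+ 2 * g ^+ 2
    + (e ^+ 2 + h ^+ 2 + c * e * g / h - 1) * x.
Proof.
move=> h0 hcol6 xE; apply/eqP; rewrite -subr_eq0; apply/eqP.
transitivity ((x ^+ 2 - (d ^+ 2 + c * e * g / h)) * (x + h ^+ 2)
  - (e ^+ 2 + f ^+ 2 + g ^+ 2 + h ^+ 2 - 1) * x).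
  by rewrite /detK0; field.
by rewrite xE hcol6 !subrr !mul0r subr0.
Qed.

Lemma detK0_root_le3 (R : realFieldType) (b c d e f g h x : R) :
  b ^+ 2 + c ^+ 2 + d ^+ 2 = 1 -> e ^+ 2 + f ^+ 2 + g ^+ 2 + h ^+ 2 = 1 ->
  detK0 d f g h x = 0 -> x <= 3.
Proof.
move=> hcol5 hcol6 k0; rewrite leNgt; apply/negP => x3.
have d1 : d ^+ 2 <= 1 by nra.
have fg1 : f ^+ 2 + g ^+ 2 <= 1 by nra.
have gh1 : g ^+ 2 + h ^+ 2 <= 1 by nra.
have hx : 0 <= h ^+ 2 * x ^+ 2 by rewrite mulr_ge0 ?sqr_ge0.
have dgh : d ^+ 2 * (g ^+ 2 + h ^+ 2) <= 1.
  by rewrite -[leRHS]mulr1 ler_pM ?addr_ge0 ?sqr_ge0.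
have bx : (f ^+ 2 + g ^+ 2 + d ^+ 2) * x <= 2 * x by rewrite ler_wpM2r; lra.
have x9 : 9 * x <= x ^+ 3.
  rewrite exprS mulrC ler_wpM2l ?(le_trans _ (ltW x3)) //; nra.
by move: k0; rewrite /detK0; lra.
Qed.

(** * The model matrix in coordinates *)

(** The column vector with the given six entries. *)
Definition col6 (R : realType) (v1 v2 v3 v4 v5 v6 : R[i]) : 'cV[R[i]]_6 :=
  \col_(k < 6) [:: v1; v2; v3; v4; v5; v6]`_k.

Lemma col6E (R : realType) (v : 'cV[R[i]]_6) :
  exists v1 v2 v3 v4 v5 v6, v = col6 v1 v2 v3 v4 v5 v6.
Proof.
exists (v (inord 0) 0), (v (inord 1) 0), (v (inord 2) 0), (v (inord 3) 0),
  (v (inord 4) 0), (v (inord 5) 0).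
apply/matrixP => k j; rewrite ord1 mxE -{1}(inord_val k).
by case: k => [[|[|[|[|[|[|k]]]]]] hk].
Qed.

Lemma col6_inj (R : realType) (v1 v2 v3 v4 v5 v6 u1 u2 u3 u4 u5 u6 : R[i]) :
  col6 v1 v2 v3 v4 v5 v6 = col6 u1 u2 u3 u4 u5 u6 ->
  [/\ v1 = u1, v2 = u2 & v3 = u3] /\ [/\ v4 = u4, v5 = u5 & v6 = u6].
Proof.
move=> /matrixP vu; have {}vu k : (k < 6)%N ->
    [:: v1; v2; v3; v4; v5; v6]`_k = [:: u1; u2; u3; u4; u5; u6]`_k.
  by move=> k6; have := vu (Ordinal k6) 0; rewrite !mxE.
split; split; [exact: (vu 0%N)|exact: (vu 1%N)|exact: (vu 2%N)|
  exact: (vu 3%N)|exact: (vu 4%N)|exact: (vu 5%N)].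
Qed.

Lemma col6D (R : realType) (v1 v2 v3 v4 v5 v6 u1 u2 u3 u4 u5 u6 : R[i]) :
  col6 v1 v2 v3 v4 v5 v6 + col6 u1 u2 u3 u4 u5 u6 =
  col6 (v1 + u1) (v2 + u2) (v3 + u3) (v4 + u4) (v5 + u5) (v6 + u6).
Proof.
apply/matrixP => k j; rewrite !mxE.
by case: k => [[|[|[|[|[|[|k]]]]]] hk].
Qed.

Lemma col6Z (R : realType) (k v1 v2 v3 v4 v5 v6 : R[i]) :
  k *: col6 v1 v2 v3 v4 v5 v6 =
  col6 (k * v1) (k * v2) (k * v3) (k * v4) (k * v5) (k * v6).
Proof.
apply/matrixP => l j; rewrite !mxE.
by case: l => [[|[|[|[|[|[|l]]]]]] hl].
Qed.

Lemma col60 (R : realType) : col6 0 0 0 0 0 0 = 0 :> 'cV[R[i]]_6.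
Proof.
apply/matrixP => k j; rewrite !mxE.
by case: k => [[|[|[|[|[|[|k]]]]]] hk].
Qed.

Lemma cdot_col6 (R : realType) (v1 v2 v3 v4 v5 v6 u1 u2 u3 u4 u5 u6 : R[i]) :
  cdot (col6 v1 v2 v3 v4 v5 v6) (col6 u1 u2 u3 u4 u5 u6) =
  v1 * u1^*%R + v2 * u2^*%R + v3 * u3^*%R +
  v4 * u4^*%R + v5 * u5^*%R + v6 * u6^*%R.
Proof. by rewrite /cdot !big_ord_recl big_ord0 !mxE /= addr0 !addrA. Qed.

Lemma modelM_mul (R : realType) (b c d e f g h : R) (v1 v2 v3 v4 v5 v6 : R[i]) :
  modelM b c d e f g h *m col6 v1 v2 v3 v4 v5 v6 =
  col6 v4 (b%:C * v5) (c%:C * v5 + e%:C * v6) (d%:C * v5 + f%:C * v6)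
    (g%:C * v6) (h%:C * v6).
Proof.
apply/matrixP => k j; rewrite ord1 !mxE !big_ord_recl big_ord0 !mxE /=.
case: k => [[|[|[|[|[|[|k]]]]]] hk] //=;
  rewrite ?rmorph0 ?rmorph1 ?mul0r ?mul1r ?add0r ?addr0 //.
Qed.

Lemma modelM_adj_mul (R : realType) (b c d e f g h : R)
    (v1 v2 v3 v4 v5 v6 : R[i]) :
  (modelM b c d e f g h)^t* *m col6 v1 v2 v3 v4 v5 v6 =
  col6 0 0 0 v1 (b%:C * v2 + c%:C * v3 + d%:C * v4)
    (e%:C * v3 + f%:C * v4 + g%:C * v5 + h%:C * v6).
Proof.
apply/matrixP => k j; rewrite ord1 !mxE !big_ord_recl big_ord0 !mxE /=.
case: k => [[|[|[|[|[|[|k]]]]]] hk] //=;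
  rewrite ?conj_real ?rmorph0 ?rmorph1
    ?mul0r ?mul1r ?add0r ?addr0 ?addrA //.
Qed.

Lemma detK0_C (R : realType) (d f g h x : R) :
  (detK0 d f g h x)%:C = detK0 d%:C f%:C g%:C h%:C x%:C.
Proof. by rewrite /detK0 !(rmorphD, rmorphN, rmorphM, rmorphXn). Qed.

Lemma detK1_C (R : realType) (d f g h x : R) :
  (detK1 d f g h x)%:C = detK1 d%:C f%:C g%:C h%:C x%:C.
Proof. by rewrite /detK1 !(rmorphD, rmorphN, rmorphM, rmorphXn). Qed.

Lemma column_relations_C (R : realType) (b c d e f g h : R) :
  b ^+ 2 + c ^+ 2 + d ^+ 2 = 1 -> e ^+ 2 + f ^+ 2 + g ^+ 2 + h ^+ 2 = 1 ->
  c * e + d * f = 0 ->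
  [/\ b%:C ^+ 2 + c%:C ^+ 2 + d%:C ^+ 2 = 1,
      e%:C ^+ 2 + f%:C ^+ 2 + g%:C ^+ 2 + h%:C ^+ 2 = 1 &
      c%:C * e%:C + d%:C * f%:C = 0].
Proof.
by move=> h1 h2 h3; split; rewrite -?rmorphXn -?rmorphM -!rmorphD /= ?h1 ?h2 ?h3.
Qed.

(** * Disks as numerical ranges of the model matrix *)

(** U and W are the squared norms of the first three and of the last three
    coordinates of an extremal vector. Multiplying the latter by s changes the
    modulus of its Rayleigh quotient from l / 2 to r. Intermediate value theorem
    for a quadratic polynomial between s = 0 and s = 1. *)
Lemma scaling_parameter (R : rcfType) (l U W r : R) :
  0 <= r -> 2 * r <= l -> 0 <= U -> 0 <= W ->
  exists s, s * l * U + s ^+ 2 * (l / 2 * (W - U)) = r * (U + s ^+ 2 * W).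
Proof.
move=> r0 rl U0 W0.
pose p := Poly [:: - (r * U); l * U; l / 2 * (W - U) - r * W].
have pE s : p.[s] = s * l * U + s ^+ 2 * (l / 2 * (W - U)) - r * (U + s ^+ 2 * W).
  by rewrite horner_Poly /=; ring.
have [|s _ /rootP] := @poly_ivt _ p 0 1 ler01; last first.
  by rewrite pE => /eqP; rewrite subr_eq0 => /eqP; exists s.
rewrite !pE; apply/andP; split; first by nra.
have -> : 1 * l * U + 1 ^+ 2 * (l / 2 * (W - U)) - r * (U + 1 ^+ 2 * W)
   = (l - 2 * r) * (U + W) / 2 by field.
by rewrite divr_ge0 // mulr_ge0 ?subr_ge0 ?addr_ge0.
Qed.

Section Model.
Context (R : realType) (b c d e f g h : R).
Context (hcol5 : b ^+ 2 + c ^+ 2 + d ^+ 2 = 1).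
Context (hcol6 : e ^+ 2 + f ^+ 2 + g ^+ 2 + h ^+ 2 = 1).
Context (horth : c * e + d * f = 0).
Local Notation M := (modelM b c d e f g h).

(** The numerical range is stable under conjugation, because M is real. *)
Lemma disk_center_real z (r : R) : 0 < r ->
  numerical_range M = [set w : R[i] | `|w - z| <= r%:C]%classic ->
  z^*%R = z.
Proof.
move=> r0 WM.
have conjW w : `|w - z| <= r%:C -> `|w^*%R - z| <= r%:C.
  move=> wz; have : numerical_range M w by rewrite WM.
  move=> /numerical_rangeP[v v1 wE].
  suff : numerical_range M w^*%R by rewrite WM.
  have [v1' [v2 [v3 [v4 [v5 [v6 vE]]]]]] := col6E v.
  apply/numerical_rangeP; exists (col6 v1'^*%R v2^*%R v3^*%R v4^*%R v5^*%R v6^*%R).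
    by rewrite cdot_col6 -[RHS](rmorph1 Num.conj) -v1 vE cdot_col6 !rmorphD !rmorphM.
  rewrite wE vE !modelM_mul !cdot_col6 !(rmorphD, rmorphM) /= !conj_real //.
(* If z is not real, the point of the disk farthest from the real axis on the
   side of z has its conjugate outside the disk. *)
pose y : R[i] := z - z^*%R.
have [y0|yn0] := eqVneq y 0; first by apply/eqP; rewrite eq_sym -subr_eq0; exact/eqP.
have ny0 : `|y| != 0 by rewrite normr_eq0.
have yc : y^*%R = - y by rewrite /y rmorphB /= conjCK opprB.
have nr : (r%:C)^*%R = r%:C by exact: conj_real.
have r0' : 0 < r%:C by rewrite ltr0C.
have := conjW (z + r%:C * (y / `|y|)); rewrite addrC addKr.
rewrite !normrM normrV ?unitfE // normr_id divff // mulr1 (gtr0_norm r0').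
move=> /(_ (lexx _)).
have -> : (z + r%:C * (y / `|y|))^*%R - z = - (r%:C / `|y| + 1) * y.
  rewrite rmorphD !rmorphM /= fmorphV /= nr yc conj_normC /y; field.
  exact: ny0.
have k0 : 0 <= r%:C / `|y| + 1 by rewrite ltW // ltr_wpDl // divr_ge0 // ltW.
rewrite normrM normrN (ger0_norm k0).
by rewrite mulrDl mul1r mulfVK // gerDl normr_le0 (negPf yn0).
Qed.

(** In the direction w = t + i s the disk of center a and radius r has support
    l / 2. The bound l >= 1 holds because the span of the first and fourth basis
    vectors already contributes the disk of center 0 and radius 1 / 2. *)
Lemma disk_support_det (a r t s : R) : 0 < r ->
  numerical_range M =
    [set w : R[i] | `|w - a%:C| <= r%:C]%classic ->
  t ^+ 2 + s ^+ 2 = 1 ->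
  let l := 2 * (r + a * t) in
  1 <= l /\
  detK0 d f g h (l ^+ 2 - 1) + 2 * l * t * detK1 d f g h (l ^+ 2 - 1) = 0.
Proof.
move=> r0 WM ts l.
have diskW := numerical_range_disk WM.
pose w : R[i] := t +i* s.
have wc : w^*%R = t -i* s by [].
have ww : w * w^*%R = 1.
  by rewrite wc; apply/eqP; rewrite eq_complex /= -ts; apply/andP; split; apply/eqP; ring.
have w1 : `|w| = 1 by rewrite normc_def /= ts sqrtr1.
have wD : w + w^*%R = (2 * t)%:C.
  by rewrite wc; apply/eqP; rewrite eq_complex /=; apply/andP; split; apply/eqP; ring.
have lE : l%:C = 2 * r%:C + a%:C * (w + w^*%R).
  rewrite wD -!rmorphM -[2](rmorph_nat (real_complex R)) -rmorphM -rmorphD /l.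
  by congr (_%:C); ring.
clearbody l.
have ac : (a%:C)^*%R = a%:C := conj_real a.
have ge0 u : 0 <= l%:C * cdot u u - w * cdot (M *m u) u
                   - (w * cdot (M *m u) u)^*%R.
  have := diskW u; rewrite -[X in X <= _]mul1r -w1 -normrM => /add_conj_le.
  have nc := cdotC u u; move: (cdot u u) (cdot _ u) nc => n m nc.
  rewrite !rmorphM rmorphB /= rmorphM /= ac nc lE.
  by congr (0 <= _); ring.
have [hcol5' hcol6' horth'] := column_relations_C hcol5 hcol6 horth.
have l1 : 1 <= l.
  have := ge0 (col6 1 0 0 w^*%R 0 0).
  rewrite modelM_mul !cdot_col6 !mulr0 !rmorph0 !mulr0 !addr0 !mul0r !addr0.
  rewrite rmorph1 !mulr1 conjCK ww rmorph1 [w^*%R * w]mulrC ww.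
  have -> : l%:C * (1 + 1) - 1 - 1 = (2 * (l - 1))%:C.
    by rewrite rmorphM rmorphB rmorph1 rmorph_nat; ring.
  by rewrite ler0c pmulr_rge0 // subr_ge0.
split=> //.
pose p : R[i] := a%:C + r%:C * w^*%R.
have : numerical_range M p.
  by rewrite WM /= /p addrC addKr normrM norm_conjC w1 mulr1 gtr0_norm // ltr0C.
move=> /numerical_rangeP[v v1 pE].
have := support_eigenvector ge0 (v := v); rewrite -pE v1.
have -> : l%:C * 1 - w * p - (w * p)^*%R = 0.
  have -> : w * p = a%:C * w + r%:C.
    by rewrite /p mulrDr [w * a%:C]mulrC [w * (_ * _)]mulrCA ww mulr1.
  by rewrite rmorphD rmorphM /= ac conj_real lE; ring.
move=> /(_ erefl).
have [v1' [v2 [v3 [v4 [v5 [v6 vE]]]]]] := col6E v.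
rewrite vE modelM_mul modelM_adj_mul !col6Z col6D => /col6_inj[[e1 e2 e3] [e4 e5 e6]].
have vn0 : ~ [/\ v1' = 0, v2 = 0 & v3 = 0] \/ ~ [/\ v4 = 0, v5 = 0 & v6 = 0].
  apply: contrapT => /not_orP[/contrapT[z1 z2 z3] /contrapT[z4 z5 z6]].
  move: v1; rewrite vE z1 z2 z3 z4 z5 z6 col60 cdotE mulmx0 mxE => /eqP.
  by rewrite eq_sym oner_eq0.

have l0 : l%:C != 0 by rewrite fmorph_eq0 gt_eqF // (lt_le_trans ltr01).
rewrite !mulr0 !addr0 in e1 e2 e3.
have l2 : l%:C ^+ 2 = 1 + (l ^+ 2 - 1)%:C.
  by rewrite rmorphB rmorphXn rmorph1 addrC subrK.
have := eigenvector_det ww l2 l0 hcol5' hcol6' horth' e1 e2 e3 e4 e5 e6 vn0.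
rewrite wD -detK0_C -detK1_C -!rmorphM -rmorphD => /complexI <-.
by ring.
Qed.

Lemma disk_center_eq0 (a r : R) : 0 < r -> h != 0 ->
  numerical_range M =
    [set w : R[i] | `|w - a%:C| <= r%:C]%classic -> a = 0.
Proof.
move=> r0 hn0 WM; apply/eqP; apply: contraT => an0.
(* For a nonzero, t = (l - 2 r) / (2 a); the polynomial p in l is a times the
   determinant, and it vanishes at more points than its degree. *)
pose B := f ^+ 2 + g ^+ 2 + d ^+ 2.
pose E := d ^+ 2 * h - d * f * g - h.
pose p := Poly [:: a * (h ^+ 2 + B - 1 - d ^+ 2 * (g ^+ 2 + h ^+ 2));
  - 2 * r * E; a * (3 - 2 * h ^+ 2 - B) + E; - 4 * r * h;
  a * (h ^+ 2 - 3) + 2 * h; 2 * r * h; a - h].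
pose l k : R := 2 * (r + a * (k%:R / 7)).
have pl (k : nat) : (k < 7)%N -> root p (l k).
  move=> k7; pose t : R := k%:R / 7.
  have t0 : 0 <= t by rewrite divr_ge0.
  have t1 : t <= 1 by rewrite ler_pdivrMr // mul1r ler_nat ltnW.
  have := disk_support_det (t := t) (s := Num.sqrt (1 - t ^+ 2)) r0 WM.
  rewrite sqr_sqrtr ?subr_ge0 ?expr_le1 // addrC subrK => /(_ erefl)[_].
  rewrite -/(l k) /root horner_Poly /= => det0.
  apply/eqP; rewrite -[RHS](mulr0 a) -[in RHS]det0 /detK0 /detK1 /E /B /l -/t.
  by ring.
have /polyP/(_ 5) : p = 0.
  apply: (@roots_geq_poly_eq0 _ _ [seq l k | k <- iota 0 7]).
  - by apply/allP => x /mapP[k]; rewrite mem_iota => /andP[_ k7] ->; exact: pl.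
  - rewrite map_inj_uniq ?iota_uniq // => j k jk.
    have : a * (j%:R - k%:R) = 0.
      transitivity (7 / 2 * (l j - l k)); first by rewrite /l; field.
      by rewrite jk subrr mulr0.
    by move/eqP; rewrite mulf_eq0 (negPf an0) subr_eq0 eqr_nat => /eqP.
  - by rewrite size_map size_iota size_Poly.
rewrite coef_Poly coef0 /= => /eqP.
by rewrite !mulf_eq0 pnatr_eq0 /= (gt_eqF r0) (negPf hn0).
Qed.

(** The leading 2 by 2 minor of K at w = 1 is nonnegative. *)
Lemma model_disk_minor_ge0 (l x : R) : 0 < l -> 0 <= x -> d != 0 ->
  l ^+ 2 = 1 + x ->
  numerical_range M = [set w : R[i] | `|w - 0| <= (l / 2)%:C]%classic ->
  d ^+ 2 <= x ^+ 2.
Proof.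
move=> l0 x0 d0 l2 WM.
(* The last three coordinates are (l times) a vector (x + d^2, l d, 0) at which
   the form of K is (x + d^2) times the minor; the first three minimize the form
   of l - (M + M'). *)
pose v1 := x + d ^+ 2.
pose v := col6 v1%:C (l * b * d)%:C (l * c * d)%:C (l * v1)%:C (l ^+ 2 * d)%:C 0.
have := numerical_range_disk WM v; rewrite mul0r subr0 => /add_conj_le.
rewrite /v modelM_mul !cdot_col6 !mulr0 !rmorph0 !mulr0 !addr0 !conj_real.
rewrite -!(rmorphM, rmorphD) /= -[2](rmorph_nat (real_complex R)).
rewrite conj_real -!(rmorphM, rmorphN, rmorphD) /= ler0c.
set q := (X in 0 <= X -> _).
have -> : q = l * v1 * (x ^+ 2 - d ^+ 2).
  rewrite /q /v1 ; apply/eqP; rewrite -subr_eq0; apply/eqP.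
  have xE : x = l ^+ 2 - 1 by rewrite l2 addrC addKr.
  transitivity (- l ^+ 3 * d ^+ 2 * (b ^+ 2 + c ^+ 2 + d ^+ 2 - 1)); last first.
    by rewrite hcol5; ring.
  by rewrite xE; field.
by rewrite pmulr_rge0 ?subr_ge0 // mulr_gt0 // ltr_wpDl // exprn_even_gt0.
Qed.

Lemma model_disk_necessary : d != 0 -> h != 0 ->
  circular_disk (numerical_range M) ->
  exists x, [/\ 0 <= x, detK0 d f g h x = 0, detK1 d f g h x = 0
              & d ^+ 2 <= x ^+ 2].
Proof.
move=> d0 hn0 [z [r [r0 WM]]].
have zE : z = (complex.Re z)%:C.
  rewrite RRe_real //; apply/CrealP; exact: disk_center_real WM.
rewrite zE in WM; have z0 := disk_center_eq0 r0 hn0 WM; rewrite z0 in WM.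
have [] := @disk_support_det _ _ 0 1 r0 WM.
  by rewrite expr0n expr1n add0r.
have [] := @disk_support_det _ _ 1 0 r0 WM.
  by rewrite expr0n expr1n addr0.
rewrite !mul0r !mulr0 !addr0 mul0r addr0 mulr1 => l1 det1 _ det0.
exists ((2 * r) ^+ 2 - 1); split => //.
- by rewrite subr_ge0 exprn_ege1.
- move: det1; rewrite det0 add0r => /eqP; rewrite mulf_eq0 => /orP[|/eqP//].
  by rewrite gt_eqF // mulr_gt0 // mulr_gt0.
apply: (@model_disk_minor_ge0 (2 * r)) => //; first by rewrite mulr_gt0.
- by rewrite subr_ge0 exprn_ege1.
- by rewrite addrC subrK.
by rewrite [2 * r]mulrC mulfK ?pnatr_eq0.
Qed.

(** When detK0 x = detK1 x = 0, the form of l - (w M + w' M') is, up to a positive factor, a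
    combination of five squares. *)
Lemma support_form_LDL (l x : R) (w v1 v2 v3 v4 v5 v6 : R[i]) :
  l ^+ 2 = 1 + x -> `|w| = 1 ->
  detK0 d f g h x = 0 -> detK1 d f g h x = 0 ->
  let v := col6 v1 v2 v3 v4 v5 v6 in
  (x * (x ^+ 2 - d ^+ 2) * l)%:C *
     (l%:C * cdot v v - w * cdot (M *m v) v - (w * cdot (M *m v) v)^*%R) =
  (x * (x ^+ 2 - d ^+ 2))%:C *
    (`|l%:C * v1 - w * v4| ^+ 2 + `|l%:C * v2 - w * b%:C * v5| ^+ 2
     + `|l%:C * v3 - w * (c%:C * v5 + e%:C * v6)| ^+ 2)
  + (x ^+ 2 - d ^+ 2)%:C *
     `|x%:C * v4 - l%:C * w * (d%:C * v5 + f%:C * v6)| ^+ 2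
  + `|(x ^+ 2 - d ^+ 2)%:C * v5
      - (d%:C * f%:C + l%:C * w * g%:C * x%:C) * v6| ^+ 2.
Proof.
move=> l2 w1 k0 k1 v.
have ww := norm1_mul_conj w1.
have [hcol5' hcol6' horth'] := column_relations_C hcol5 hcol6 horth.
have l2C : l%:C ^+ 2 = 1 + x%:C by rewrite -rmorphXn l2 rmorphD rmorph1.
have detC : detK0 d%:C f%:C g%:C h%:C x%:C
     + l%:C * (w + w^*%R) * detK1 d%:C f%:C g%:C h%:C x%:C = 0.
  by rewrite -detK0_C -detK1_C k0 k1 !rmorph0 mulr0 addr0.
have S := support_form_schur v1 v2 v3 v4 v5 v6 v1^*%R v2^*%R v3^*%R v4^*%R
  v5^*%R v6^*%R ww l2C hcol5' hcol6' horth'.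
have L := schur_form_LDL v4 v5 v6 v4^*%R v5^*%R v6^*%R ww l2C detC.
rewrite /v modelM_mul !cdot_col6 !normCK.
rewrite !(rmorphM, rmorphB, rmorphD, rmorphXn) /= !conj_real !conjCK.
move: S; set A := (X in X = _) => S.
transitivity (x%:C * (x%:C ^+ 2 - d%:C ^+ 2) * A); first by rewrite /A; ring.
by rewrite S mulrDr L; ring.
Qed.

Lemma model_support_ge0 (l x : R) (w : R[i]) (v : 'cV[R[i]]_6) :
  0 < l -> 0 < x -> l ^+ 2 = 1 + x -> `|w| = 1 ->
  detK0 d f g h x = 0 -> detK1 d f g h x = 0 -> d ^+ 2 < x ^+ 2 ->
  0 <= l%:C * cdot v v - w * cdot (M *m v) v - (w * cdot (M *m v) v)^*%R.
Proof.
move=> l0 x0 l2 w1 k0 k1 xd.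
have m0 : 0 < x ^+ 2 - d ^+ 2 by rewrite subr_gt0.
have k0' : 0 < (x * (x ^+ 2 - d ^+ 2) * l)%:C by rewrite ltr0C !mulr_gt0.
have [v1 [v2 [v3 [v4 [v5 [v6 ->]]]]]] := col6E v.
rewrite -(pmulr_rge0 _ k0') (support_form_LDL _ _ _ _ _ _ l2 w1 k0 k1).
by rewrite !addr_ge0 ?mulr_ge0 ?addr_ge0 ?exprn_ge0 // ler0c ?mulr_ge0 // ltW.
Qed.

Lemma model_range_bound (l x : R) (v : 'cV[R[i]]_6) :
  0 < l -> 0 < x -> l ^+ 2 = 1 + x ->
  detK0 d f g h x = 0 -> detK1 d f g h x = 0 -> d ^+ 2 < x ^+ 2 ->
  2 * `|cdot (M *m v) v| <= l%:C * cdot v v.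
Proof.
move=> l0 x0 l2 k0 k1 xd.
have [w w1 wE] := phase_exists (cdot (M *m v) v).
have := model_support_ge0 v l0 x0 l2 w1 k0 k1 xd.
by rewrite wE conj_normC -addrA -opprD subr_ge0 -mulr2n mulr_natl.
Qed.

(** In each direction the boundary of the disk is reached, by a vector whose first
    three coordinates are determined by the last three and are not all 0. *)
Lemma model_range_attained (l x : R) (w : R[i]) :
  0 < l -> 0 < x -> l ^+ 2 = 1 + x -> `|w| = 1 -> f != 0 ->
  detK0 d f g h x = 0 -> detK1 d f g h x = 0 -> d ^+ 2 < x ^+ 2 ->
  exists v1 v2 v3 v4 v5 v6,
    let v := col6 v1 v2 v3 v4 v5 v6 in
    [/\ l%:C * v1 = w * v4, l%:C * v2 = w * b%:C * v5,
        l%:C * v3 = w * (c%:C * v5 + e%:C * v6),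
        0 < `|v1| ^+ 2 + `|v2| ^+ 2 + `|v3| ^+ 2 &
        2 * (w * cdot (M *m v) v) = l%:C * cdot v v].
Proof.
move=> l0 x0 l2 w1 f0 k0 k1 xd.
have m0 : 0 < x ^+ 2 - d ^+ 2 by rewrite subr_gt0.
have l0C : l%:C != 0 by rewrite fmorph_eq0 gt_eqF.
have w0 : w != 0 by rewrite -normr_gt0 w1.
(* (v4, v5, v6) is the last column of the adjugate of K. *)
pose v4 : R[i] := l%:C * w * (f%:C * x%:C + l%:C * w * d%:C * g%:C).
pose v5 : R[i] := d%:C * f%:C + l%:C * w * g%:C * x%:C.
pose v6 : R[i] := (x ^+ 2 - d ^+ 2)%:C.
pose v1 : R[i] := w * v4 / l%:C.
pose v2 : R[i] := w * b%:C * v5 / l%:C.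
pose v3 : R[i] := w * (c%:C * v5 + e%:C * v6) / l%:C.
have e1 : l%:C * v1 = w * v4 by rewrite mulrC mulfVK.
have e2 : l%:C * v2 = w * b%:C * v5 by rewrite mulrC mulfVK.
have e3 : l%:C * v3 = w * (c%:C * v5 + e%:C * v6) by rewrite mulrC mulfVK.
have e4 : x%:C * v4 = l%:C * w * (d%:C * v5 + f%:C * v6).
  by rewrite /v4 /v5 /v6 rmorphB !rmorphXn /=; ring.
have e5 : (x ^+ 2 - d ^+ 2)%:C * v5
      = (d%:C * f%:C + l%:C * w * g%:C * x%:C) * v6.
  by rewrite /v5 /v6 mulrC.
clearbody v1 v2 v3 v4 v5.
exists v1, v2, v3, v4, v5, v6; split => //.
  rewrite lt_def addr_ge0 ?addr_ge0 ?exprn_ge0 // andbT.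
  apply: contraTneq isT => /eqP.
  rewrite !paddr_eq0 ?addr_ge0 ?exprn_ge0 // !expf_eq0 /= !normr_eq0.
  case/andP=> /andP[/eqP v10 /eqP v20] /eqP v30.
  have v40 : v4 = 0 by apply: (mulfI w0); rewrite -e1 v10 !mulr0.
  have cv : c%:C * v5 + e%:C * v6 = 0.
    by apply: (mulfI w0); rewrite -e3 v30 !mulr0.
  have dv : d%:C * v5 + f%:C * v6 = 0.
    by apply: (mulfI (mulf_neq0 l0C w0)); rewrite -e4 v40 !mulr0.
  have [_ _ horth'] := column_relations_C hcol5 hcol6 horth.
  have : (e ^+ 2 + f ^+ 2)%:C * v6 = 0.
    transitivity (e%:C * (c%:C * v5 + e%:C * v6) + f%:C * (d%:C * v5 + f%:C * v6)
       - (c%:C * e%:C + d%:C * f%:C) * v5).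
      by rewrite rmorphD !rmorphXn /=; ring.
    by rewrite cv dv horth'; ring.
  move/eqP; rewrite mulf_eq0 !fmorph_eq0 (gt_eqF m0) orbF gt_eqF //.
  by rewrite ltr_wpDl ?sqr_ge0 // exprn_even_gt0.
set v := col6 _ _ _ _ _ _; set p := cdot (M *m v) v.
have S0 : l%:C * cdot v v - w * p - (w * p)^*%R = 0.
  have := support_form_LDL v1 v2 v3 v4 v5 v6 l2 w1 k0 k1.
  rewrite -/v -/p e1 e2 e3 e4 e5 !subrr !normr0 !expr0n /= !addr0 !mulr0 !addr0.
  move/eqP; rewrite mulf_eq0 fmorph_eq0 gt_eqF ?mulr_gt0 //.
  by move/eqP.
have wp : w * p + (w * p)^*%R = l%:C * cdot v v.
  by apply/eqP; rewrite eq_sym -subr_eq0 opprD addrA S0.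
have le := model_range_bound v l0 x0 l2 k0 k1 xd.
have wpn : `|w * p| = `|p| by rewrite normrM w1 mul1r.
have wpE : w * p = `|w * p|.
  apply: normr_add_conj; apply/eqP; rewrite eq_le wpn !wp le andbT.
  have := @add_conj_le _ (w * p) `|p|; rewrite wpn => /(_ (lexx _)).
  by rewrite -addrA -opprD subr_ge0 wp.
by rewrite -wp mulr_natl mulr2n {4}wpE conj_normC -wpE.
Qed.

Lemma model_disk_sufficient (l x : R) :
  0 < l -> 0 < x -> l ^+ 2 = 1 + x -> f != 0 ->
  detK0 d f g h x = 0 -> detK1 d f g h x = 0 -> d ^+ 2 < x ^+ 2 ->
  numerical_range M = [set w : R[i] | `|w - 0| <= (l / 2)%:C]%classic.
Proof.
move=> l0 x0 l2 f0 k0 k1 xd; apply/seteqP; split=> p /=; rewrite subr0.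
  move=> /numerical_rangeP[v v1 ->].
  have := model_range_bound v l0 x0 l2 k0 k1 xd.
  by rewrite v1 mulr1 rmorphM fmorphV rmorph_nat /= ler_pdivlMr // mulrC.
move=> pl; have [w w1 wE] := phase_exists p.
have [v1 [v2 [v3 [v4 [v5 [v6 [e1 e2 e3 U0 vE]]]]]]] :=
  model_range_attained l0 x0 l2 w1 f0 k0 k1 xd.
have w0 : w != 0 by rewrite -normr_gt0 w1.
have [U UE] : exists U : R, `|v1| ^+ 2 + `|v2| ^+ 2 + `|v3| ^+ 2 = U%:C.
  by rewrite !sqr_normc_real -!rmorphD; eexists.
have [W WE] : exists W : R, `|v4| ^+ 2 + `|v5| ^+ 2 + `|v6| ^+ 2 = W%:C.
  by rewrite !sqr_normc_real -!rmorphD; eexists.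
have [r rE] : exists r : R, `|p| = r%:C by rewrite normc_def; eexists.
rewrite UE ltr0C in U0; rewrite rE lecR in pl.
have r0 : 0 <= r by rewrite -ler0c -rE.
have W0 : 0 <= W by rewrite -ler0c -WE !addr_ge0 // exprn_ge0.
have rl : 2 * r <= l by rewrite mulrC -ler_pdivlMr.
have [s sE] := scaling_parameter r0 rl (ltW U0) W0.
have m0 : 0 < U + s ^+ 2 * W by rewrite ltr_pwDl // mulr_ge0 // sqr_ge0.
rewrite !normCK in UE WE.
(* The scaling multiplies the contribution of B to the value by s, and that of
   C, denoted G below, by s^2. *)
pose v := col6 v1 v2 v3 (s%:C * v4) (s%:C * v5) (s%:C * v6).
have vm : cdot v v = (U + s ^+ 2 * W)%:C.
  rewrite /v cdot_col6 !rmorphM /= !conj_real.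
  by rewrite rmorphD rmorphM rmorphXn /= -UE -WE; ring.
have := numerical_range_scale M m0 vm.
suff -> : cdot (M *m v) v = p * (U + s ^+ 2 * W)%:C.
  by rewrite mulfK // fmorph_eq0 gt_eqF.
apply: (mulfI w0); rewrite mulrA wE rE -rmorphM -sE.
move: vE; rewrite /v !modelM_mul !cdot_col6.
pose G := (d%:C * v5 + f%:C * v6) * v4^*%R + g%:C * v6 * v5^*%R + h%:C * v6 * v6^*%R.
have B : w * (v4 * v1^*%R + b%:C * v5 * v2^*%R + (c%:C * v5 + e%:C * v6) * v3^*%R)
    = l%:C * U%:C.
  transitivity (w * v4 * v1^*%R + w * b%:C * v5 * v2^*%R
     + w * (c%:C * v5 + e%:C * v6) * v3^*%R); first by ring.
  by rewrite -e1 -e2 -e3 -UE; ring.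
rewrite !rmorphM /= !conj_real => vE.
have wG : w * G = l%:C / 2 * (W%:C - U%:C).
  have two0 : 2 != 0 :> R[i] by rewrite pnatr_eq0.
  apply: (mulfI two0).
  transitivity (2 * (w * (v4 * v1^* + b%:C * v5 * v2^* +
      (c%:C * v5 + e%:C * v6) * v3^* +
      (d%:C * v5 + f%:C * v6) * v4^* +
      g%:C * v6 * v5^* + h%:C * v6 * v6^*)) - 2 * (l%:C * U%:C)).
    by rewrite -B /G; ring.
  by rewrite vE -UE -WE; field.
transitivity (s%:C * (w * (v4 * v1^*%R + b%:C * v5 * v2^*%R
    + (c%:C * v5 + e%:C * v6) * v3^*%R)) + s%:C ^+ 2 * (w * G)).
  by rewrite /G; ring.
rewrite B wG !(rmorphM, rmorphD, rmorphN, rmorphXn) fmorphV rmorph_nat /=.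
by ring.
Qed.

End Model.

(** * The characterization *)

Theorem theorem8p5 (R : realType) (A : 'M[R[i]]_6) (b c d e f g h : R)
  (hA : circularly_equivalent A (modelM b c d e f g h))
  (hb : 0 <= b) (hc : 0 <= c) (hd : 0 <= d) (he : 0 <= e) (hh : 0 <= h)
  (hf0 : c * e = 0 -> 0 <= f) (hf1 : c * e <> 0 -> f <= 0)
  (hcol5 : b ^+ 2 + c ^+ 2 + d ^+ 2 = 1)
  (hcol6 : e ^+ 2 + f ^+ 2 + g ^+ 2 + h ^+ 2 = 1)
  (horth : c * e + d * f = 0)
  (hnz : c * d * e * f * g * h <> 0) :
  circular_disk (numerical_range A) <->
  0 <= d ^+ 2 + c * e * g / h /\
  (let x := Num.sqrt (d ^+ 2 + c * e * g / h) in
   [/\ c * e * g * h - d ^+ 2 * g ^+ 2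
         + (e ^+ 2 + h ^+ 2 + c * e * g / h - 1) * x = 0,
       x <= 3
     & 4 * h * x * Num.sqrt (1 + x)
         < 3 * x ^+ 2 + 2 * h ^+ 2 * x + h ^+ 2 + e ^+ 2 - d ^+ 2 - 1]).
Proof.
have [c0 d0 e0 f0 [g0 h0]] :
    [/\ c != 0, d != 0, e != 0, f != 0 & g != 0 /\ h != 0].
  by move/eqP: hnz; rewrite !mulf_eq0 !negb_or -!andbA => /and5P[? ? ? ? /andP[]].
have -> : circular_disk (numerical_range A) <->
    circular_disk (numerical_range (modelM b c d e f g h)).
  by split; apply: circular_disk_circ => //; apply: circularly_equivalent_sym.
set k := c * e * g / h.
(* k != 0 separates x^2 from d^2: the weak inequality given by K >= 0 is strict. *)
have k0 : k != 0 by rewrite !mulf_neq0 ?invr_eq0.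
have sqr_neq (x : R) : x ^+ 2 = d ^+ 2 + k -> x ^+ 2 != d ^+ 2.
  by move=> ->; rewrite -subr_eq0 addrC addKr.
have ineqE (x l : R) : 3 * x ^+ 2 + 2 * h ^+ 2 * x + h ^+ 2 + e ^+ 2 - d ^+ 2 - 1
    - 4 * h * x * l = 3 * x ^+ 2 + 2 * h ^+ 2 * x - (f ^+ 2 + g ^+ 2 + d ^+ 2)
     - 4 * h * x * l.
  by rewrite -hcol6; ring.
have sqrt_sqr (x : R) : 0 <= x -> Num.sqrt (1 + x) ^+ 2 = 1 + x.
  by move=> x0; rewrite sqr_sqrtr // addr_ge0.
split=> [diskM|[dk0 /= [det0 _ ineq]]].
  have [x [x0 det0 det1 xd]] := model_disk_necessary hcol5 hcol6 horth d0 h0 diskM.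
  have xE : x ^+ 2 = d ^+ 2 + k.
    by apply/eqP; rewrite -(@detK1_eq0 _ c d e f g h x h0 horth) det1.
  rewrite -xE sqr_ge0 sqrtr_sqr ger0_norm //=; split=> //; split.
  - by rewrite -(detK0E h0 hcol6 xE).
  - exact: detK0_root_le3 hcol5 hcol6 det0.
  rewrite -subr_gt0 ineqE.
  rewrite (slope_gt0 hcol5 hcol6 horth x0 (sqrt_sqr _ x0) det0 det1) ?sqr_neq //.
  by rewrite lt_def sqr_neq.
set x := Num.sqrt _ in det0 ineq.
have x0 : 0 <= x by exact: sqrtr_ge0.
have xE : x ^+ 2 = d ^+ 2 + k by rewrite sqr_sqrtr.
have det1 : detK1 d f g h x = 0.
  by apply/eqP; rewrite (@detK1_eq0 _ c d e f g h x h0 horth) xE.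
rewrite -(detK0E h0 hcol6 xE) in det0.
have xd : d ^+ 2 < x ^+ 2.
  rewrite -(slope_gt0 hcol5 hcol6 horth x0 (sqrt_sqr _ x0) det0 det1) ?sqr_neq //.
  by rewrite -ineqE subr_gt0.
have xgt0 : 0 < x.
  rewrite lt_def x0 andbT; apply: contraTneq xd => ->.
  by rewrite expr0n -leNgt sqr_ge0.
have l0 : 0 < Num.sqrt (1 + x) by rewrite sqrtr_gt0 ltr_pwDl.
exists 0, (Num.sqrt (1 + x) / 2); split; first by rewrite divr_gt0.
exact: (model_disk_sufficient hcol5 hcol6 horth l0 xgt0 (sqrt_sqr _ x0)).
Qed.
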